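(* Let $M$ be a regular curve in $\mathbb{R}^2$ and let $a,b$ be a parallel pair of $M$ such that at least one of the curvatures $\kappa_M(a),\kappa_M(b)$ is non-zero. The curve $\mathrm{SC}(M)$ is singular at the point $a-b$ if and only if $M$ is curved in the same side at $a,b$ and $|\kappa_M(a)|=|\kappa_M(b)|$.
   Context: All curves are smooth and regularly parameterized. A parallel pair of $M$ is a pair of points $a,b\in M$, $a\neq b$, such that the tangent lines to $M$ at $a$ and $b$ are parallel. The secant caustic is $\mathrm{SC}(M)=\mathrm{cl}\{a-b : a,b \text{ is a parallel pair of } M\}$. $\kappa_M(p)$ denotes the signed curvature of $M$ at $p$. For a parallel pair $a,b$ of non-inflexion points (a point is an inflexion point if the curvature changes sign there), let $\tau_{a-b}$ be the translation by the vector $a-b$. $M$ is curved in the same side at $a$ and $b$ if the germs of the curves $M$ and $\tau_{a-b}(M)$ at $a=\tau_{a-b}(b)$ (i.e. the germ of $M$ at $a$ and the translated germ of $M$ at $b$) lie on the same side of the tangent line to $M$ at $a$. Local natural parameterization: if $\kappa_M(b)\neq0$, let $f:(s_0,s_1)\to\mathbb{R}^2$ and $g:(t_0,t_1)\to\mathbb{R}^2$ be local arc length parameterizations of $M$ near $a$ and $b$ in the same direction (velocities at $a$ and $b$ are positive multiples of each other). There is a smooth function $t(s)$ with $f'(s)=g'(t(s))$, and $\gamma(s)=f(s)-g(t(s))$ is the local natural parameterization of the secant caustic near $a-b$. If $\kappa_M(b)=0\neq\kappa_M(a)$, exchange the roles: $t\mapsto f(s(t))-g(t)$ with $f'(s(t))=g'(t)$.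 ''$\mathrm{SC}(M)$ is singular at $a-b$'' means that this parameterization has zero velocity at the parameter value corresponding to the pair $(a,b)$. *)

(* Defs.v *)
From Stdlib Require Import Reals.
From Coquelicot Require Import Coquelicot.
Open Scope R_scope.

Definition in_interval (lo hi : Rbar) (s : R) : Prop :=
  Rbar_lt lo s /\ Rbar_lt s hi.

(* On an open interval, existence of every iterated derivative at every point
   is C^infinity smoothness. *)
Definition smooth_on (lo hi : Rbar) (h : R -> R) : Prop :=
  forall (n : nat) (s : R), in_interval lo hi s -> ex_derive_n h n s.

Definition velocity (c : R -> R * R) (s : R) : R * R :=
  (Derive (fun r => fst (c r)) s, Derive (fun r => snd (c r)) s).

Definition acceleration (c : R -> R * R) (s : R) : R * R :=
  (Derive_n (fun r => fst (c r)) 2 s, Derive_n (fun r => snd (c r)) 2 s).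

Definition dot (p q : R * R) : R := fst p * fst q + snd p * snd q.
Definition det (p q : R * R) : R := fst p * snd q - snd p * fst q.

(* Coquelicot's [norm] on [R * R] is the Euclidean norm. *)
Definition curvature (c : R -> R * R) (s : R) : R :=
  det (velocity c s) (acceleration c s) / norm (velocity c s) ^ 3.

(* The domain is an open, possibly unbounded, interval; a closed curve is
   a periodic parameterization on the whole line.  Curves are immersed, so
   a point of the curve, together with the branch through it, is given by its
   parameter. *)
Record regular_curve : Type := RegularCurve {
  dom_lo : Rbar;
  dom_hi : Rbar;
  param :> R -> R * R;
  param_smooth_fst : smooth_on dom_lo dom_hi (fun s => fst (param s));
  param_smooth_snd : smooth_on dom_lo dom_hi (fun s => snd (param s));
  param_regular :
    forall s, in_interval dom_lo dom_hi s -> velocity param s <> zero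
}.

Definition in_dom (M : regular_curve) (u : R) : Prop :=
  in_interval (dom_lo M) (dom_hi M) u.

(* The two tangent lines are allowed to coincide. *)
Definition parallel_pair (M : regular_curve) (u v : R) : Prop :=
  in_dom M u /\ in_dom M v /\ M u <> M v /\
  exists k : R, k <> 0 /\ velocity M u = scal k (velocity M v).

Definition inflexion (M : regular_curve) (u : R) : Prop :=
  exists eps : R, 0 < eps /\
    forall r s, u - eps < r < u -> u < s < u + eps ->
      curvature M r * curvature M s < 0.

(* The vector [n] is normal to the tangent line at [M u] and points towards
   the common closed half-plane. *)
Definition curved_same_side (M : regular_curve) (u v : R) : Prop :=
  ~ inflexion M u /\ ~ inflexion M v /\
  exists n : R * R, n <> zero /\ dot n (velocity M u) = 0 /\
    locally u (fun r => 0 <= dot n (minus (M r) (M u))) /\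
    locally v (fun r =>
      0 <= dot n (minus (plus (M r) (minus (M u) (M v))) (M u))).

(* [f] on (s0, s1) is an arc length parameterization, of either orientation,
   of the branch of [M] at [u], with parameter value [sa] at that point. *)
Definition arclength_param (M : regular_curve) (u : R)
    (f : R -> R * R) (s0 s1 sa : R) : Prop :=
  s0 < sa < s1 /\
  (exists phi : R -> R,
     smooth_on s0 s1 phi /\ phi sa = u /\
     forall s, s0 < s < s1 -> in_dom M (phi s) /\ f s = M (phi s)) /\
  forall s, s0 < s < s1 -> norm (velocity f s) = 1.

Definition same_direction (p q : R * R) : Prop :=
  exists k : R, 0 < k /\ p = scal k q.

Definition tangent_matching (f : R -> R * R) (s0 s1 sa : R)
    (g : R -> R * R) (t0 t1 tb : R) (h : R -> R) : Prop :=
  smooth_on s0 s1 h /\ h sa = tb /\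
  forall s, s0 < s < s1 -> t0 < h s < t1 /\ velocity f s = velocity g (h s).

(* [c] is a local natural parameterization of the secant caustic near
   [M u - M v], with parameter value [p] for the pair itself. *)
Definition natural_param (M : regular_curve) (u v : R)
    (c : R -> R * R) (p : R) : Prop :=
  exists (f : R -> R * R) (s0 s1 sa : R) (g : R -> R * R) (t0 t1 tb : R),
    arclength_param M u f s0 s1 sa /\
    arclength_param M v g t0 t1 tb /\
    same_direction (velocity f sa) (velocity g tb) /\
    ((curvature M v <> 0 /\ p = sa /\
      exists t : R -> R,
        tangent_matching f s0 s1 sa g t0 t1 tb t /\
        forall r, s0 < r < s1 -> c r = minus (f r) (g (t r)))
     \/
     (curvature M v = 0 /\ curvature M u <> 0 /\ p = tb /\
      exists s : R -> R,
        tangent_matching g t0 t1 tb f s0 s1 sa s /\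
        forall r, t0 < r < t1 -> c r = minus (f (s r)) (g r))).

(* Near the pair, a natural parameterization is unique up to shift and reversal
   of its parameter, so "some" and "every" agree here; "some" also asks for
   existence. *)
Definition SC_singular (M : regular_curve) (u v : R) : Prop :=
  exists (c : R -> R * R) (p : R),
    natural_param M u v c p /\ velocity c p = zero.

(* Main.v *)
Require Import Defs.
From Stdlib Require Import Reals Lra Ranalysis5 ClassicalEpsilon.
From Coquelicot Require Import Coquelicot.
Open Scope R_scope.

(** Let [f] and [g] be arc length parameterizations near the two points, with
    equal tangents [f' (s) = g' (t (s))].  Differentiating this equation at the
    pair gives [f'' = l g''] with [l = t'], and differentiating
    [f (s) - g (t (s))] gives the velocity [(1 - l) f'].  As [f'] is a unit
    vector, the secant caustic is singular exactly when [l = 1]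
    ([matching_derivatives]).

    Both sides of the equivalence are then read off [l].  The absolute
    curvatures are the absolute values of [det f' f''] and [det g' g'']
    ([arclength_curvature]), hence have ratio [|l|].  A curve with non-zero
    curvature lies, near a point, on the side of its tangent line to which its
    acceleration points ([arclength_side_iff], from the second derivative
    test), and [f''], [g''] are normal to the common tangent line, so the
    branches lie on the same side exactly when [l > 0].  Now [l = 1] iff
    [l > 0] and [|l| = 1] ([velocity_eq0_iff_same_side]).

    When the curvature vanishes at the second point only, the roles are
    exchanged: a singular point would force [f'' = g''], hence equal absolute
    curvatures, which is absurd.

    Since singularity asks for some natural parameterization, one has to be
    constructed for the converse ([natural_param_exists]).  This uses a smooth
    inverse function theorem twice: for the arc length, and for the function
    [det T g'], where [T] is the common tangent vector, whose derivative
    [det T g''] at the pair is the curvature of [g].  Near [T] a unit vector is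
    determined by its determinant with [T], so [t] is the local inverse of
    [det T g'] composed with [det T f']. *)

(** * Smooth functions of one variable *)

(** Differentiability [n] times, with each derivative only required to exist:
    the recursion exposes the first derivative as a function, so that the
    product and chain rules give closure properties by induction on [n]. *)
Fixpoint Ck (D : R -> Prop) (n : nat) (h : R -> R) : Prop :=
  match n with
  | O => True
  | S m => exists h' : R -> R,
      (forall x, D x -> is_derive h x (h' x)) /\ Ck D m h'
  end.

Lemma Ck_mono (D E : R -> Prop) n : forall h,
  (forall x, E x -> D x) -> Ck D n h -> Ck E n h.
Proof.
induction n as [|n IH]; intros h HED; [easy|].
intros [h' [Hd Hh']]; exists h'; split; auto.
Qed.

Lemma Ck_pred (D : R -> Prop) n : forall h, Ck D (S n) h -> Ck D n h.
Proof.
induction n as [|n IH]; intros h [h' [Hd Hh']]; [easy|].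
exists h'; auto.
Qed.

Lemma Ck_ext (D : R -> Prop) n h k :
  (forall x, D x -> locally x D) -> (forall x, D x -> h x = k x) ->
  Ck D n h -> Ck D n k.
Proof.
destruct n as [|n]; [easy|].
intros HD Hhk [h' [Hd Hh']]; exists h'; split; [|easy].
intros x Dx; apply (is_derive_ext_loc h); [|auto].
now apply (filter_imp D); [|auto].
Qed.

Lemma Ck_const (D : R -> Prop) n : forall a, Ck D n (fun _ => a).
Proof.
induction n as [|n IH]; intros a; [easy|].
exists (fun _ => 0); split; [|apply IH].
intros x _; apply @is_derive_const.
Qed.

Lemma Ck_plus (D : R -> Prop) n : forall h k,
  Ck D n h -> Ck D n k -> Ck D n (fun x => h x + k x).
Proof.
induction n as [|n IH]; intros h k; [easy|].
intros [h' [Hd Hh']] [k' [Kd Kk']]; exists (fun x => h' x + k' x); split; [|auto].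
intros x Dx; apply @is_derive_plus; auto.
Qed.

Lemma Ck_mult (D : R -> Prop) n : forall h k,
  Ck D n h -> Ck D n k -> Ck D n (fun x => h x * k x).
Proof.
induction n as [|n IH]; intros h k Hh Hk; [easy|].
generalize (Ck_pred _ _ _ Hh) (Ck_pred _ _ _ Hk); intros Hh0 Hk0.
destruct Hh as [h' [Hd Hh']], Hk as [k' [Kd Kk']].
exists (fun x => h' x * k x + h x * k' x); split.
- intros x Dx; apply @is_derive_mult; auto; intros; apply Rmult_comm.
- apply Ck_plus; auto.
Qed.

Lemma Ck_comp (D E : R -> Prop) n : forall h k,
  Ck E n h -> Ck D n k -> (forall x, D x -> E (k x)) ->
  Ck D n (fun x => h (k x)).
Proof.
induction n as [|n IH]; intros h k Hh Hk HDE; [easy|].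
generalize (Ck_pred _ _ _ Hk); intros Hk0.
destruct Hh as [h' [Hd Hh']], Hk as [k' [Kd Kk']].
exists (fun x => k' x * h' (k x)); split.
- intros x Dx; apply (is_derive_comp h k); auto.
- apply Ck_mult; auto.
Qed.

Lemma Ck_inv (D : R -> Prop) n : forall h,
  (forall x, D x -> h x <> 0) -> Ck D n h -> Ck D n (fun x => / h x).
Proof.
induction n as [|n IH]; intros h Hn0 Hh; [easy|].
generalize (IH h Hn0 (Ck_pred _ _ _ Hh)); intros Hi.
destruct Hh as [h' [Hd Hh']].
exists (fun x => (-1 * h' x) * (/ h x * / h x)); split.
- intros x Dx.
  replace ((-1 * h' x) * (/ h x * / h x)) with (- h' x / h x ^ 2)
    by (field; auto).
  apply is_derive_inv; auto.
- repeat apply Ck_mult; auto; apply Ck_const.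
Qed.

Lemma Ck_sqrt (D : R -> Prop) n : forall h,
  (forall x, D x -> 0 < h x) -> Ck D n h -> Ck D n (fun x => sqrt (h x)).
Proof.
induction n as [|n IH]; intros h Hpos Hh; [easy|].
generalize (IH h Hpos (Ck_pred _ _ _ Hh)); intros Hs.
destruct Hh as [h' [Hd Hh']].
exists (fun x => h' x * / (2 * sqrt (h x))); split.
- intros x Dx; apply (is_derive_comp sqrt h); auto.
  apply is_derive_Reals, derivable_pt_lim_sqrt; auto.
- apply Ck_mult; [easy|]; apply Ck_inv.
  + intros x Dx; generalize (sqrt_lt_R0 _ (Hpos x Dx)); lra.
  + apply Ck_mult; [apply Ck_const|easy].
Qed.

Lemma in_interval_locally lo hi s :
  in_interval lo hi s -> locally s (in_interval lo hi).
Proof.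
intros [H1 H2].
now apply filter_and; [apply (open_Rbar_gt lo)|apply (open_Rbar_lt hi)].
Qed.

(** Bridge to iterated derivatives; the open interval matters in the direction
    from right to left, where the chosen derivative has to agree with [Derive]
    on a neighbourhood. *)
Lemma smooth_Ck lo hi h :
  smooth_on lo hi h <-> forall n, Ck (in_interval lo hi) n h.
Proof.
split.
- intros H n; revert h H; induction n as [|n IH]; intros h H; [easy|].
  exists (Derive h); split.
  + intros x Dx; apply Derive_correct, (H 1%nat x Dx).
  + apply IH; intros m s Ds.
    destruct m as [|m]; [easy|].
    apply (ex_derive_ext (Derive_n h (S m))); [|apply (H (S (S m)) s Ds)].
    intros t; rewrite <- (Nat.add_1_r m), <- Derive_n_comp; easy.
- intros H n; specialize (H n); revert h H.
  induction n as [|n IH]; intros h H s Ds; [easy|].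
  destruct H as [h' [Hd Hh']].
  destruct n as [|n]; [exists (h' s); now apply Hd|].
  apply (ex_derive_ext_loc (Derive_n h' n)); [|now apply (IH h')].
  generalize (in_interval_locally _ _ _ Ds); apply filter_imp; intros t Dt.
  change (Derive_n h' n t = Derive_n h (S n) t).
  rewrite <- (Nat.add_1_r n), <- Derive_n_comp.
  apply Derive_n_ext_loc.
  generalize (in_interval_locally _ _ _ Dt); apply filter_imp; intros r Dr.
  symmetry; now apply is_derive_unique, Hd.
Qed.

Lemma smooth_Ck_Derive lo hi h n :
  smooth_on lo hi h -> Ck (in_interval lo hi) n (Derive h).
Proof.
intros Hh.
destruct (proj1 (smooth_Ck _ _ _) Hh (S n)) as [h' [H1 H2]].
apply (Ck_ext _ _ h'); [apply in_interval_locally| |easy].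
intros x Dx; symmetry; now apply is_derive_unique, H1.
Qed.

(** * Inverse functions *)

(** The inverse takes arbitrary values off the image of the interval, so its
    properties are stated on the open image only. *)
Lemma inverse_increasing (a b : R) (F F' : R -> R) :
  a < b ->
  (forall x, a <= x <= b -> is_derive F x (F' x)) ->
  (forall x, a <= x <= b -> 0 < F' x) ->
  exists G : R -> R,
    (forall x, a < x < b -> F a < F x < F b /\ G (F x) = x) /\
    (forall y, F a < y < F b ->
       a < G y < b /\ F (G y) = y /\ is_derive G y (/ F' (G y))).
Proof.
intros Hab Hd Hpos.
assert (Hinc : forall x y, a <= x -> x < y -> y <= b -> F x < F y).
{ intros x y Hx Hxy Hy.
  destruct (MVT_cor2 F F' x y Hxy) as [c [Hc1 Hc2]].
  - intros c Hc; apply is_derive_Reals, Hd; lra.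
  - assert (0 < F' c) by (apply Hpos; lra); nra. }
assert (Hder : forall x, a <= x <= b -> derivable_pt F x).
{ intros x Hx; exists (F' x); apply is_derive_Reals, Hd, Hx. }
assert (Hcont : forall x, a <= x <= b -> continuity_pt F x).
{ intros x Hx; apply derivable_continuous_pt, Hder, Hx. }
assert (HG : forall y, exists x, F a <= y <= F b -> a <= x <= b /\ F x = y).
{ intros y; destruct (Rle_dec (F a) y) as [Hay|Hay]; [|exists 0; lra].
  destruct (Rle_dec y (F b)) as [Hyb|Hyb]; [|exists 0; lra].
  destruct (f_interv_is_interv F a b y Hab (conj Hay Hyb) Hcont) as [x Hx].
  now exists x. }
pose (G := fun y => proj1_sig (constructive_indefinite_description _ (HG y))).
assert (GP : forall y, F a <= y <= F b -> a <= G y <= b /\ F (G y) = y).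
{ intros y; unfold G.
  now destruct (constructive_indefinite_description _ (HG y)) as [x Hx]. }
assert (GS : forall y, F a < y < F b -> a < G y < b).
{ intros y Hy; destruct (GP y) as [[H1 H2] H3]; [lra|].
  destruct H1 as [H1|H1]; [|rewrite <- H1 in H3; lra].
  destruct H2 as [H2|H2]; [lra|rewrite H2 in H3; lra]. }
assert (GF : forall x, a < x < b -> F a < F x < F b /\ G (F x) = x).
{ intros x Hx.
  assert (F a < F x < F b) by (split; apply Hinc; lra).
  split; [easy|].
  destruct (GP (F x)) as [H1 H2]; [lra|].
  destruct (Rtotal_order (G (F x)) x) as [H3|[H3|H3]]; [|easy|];
    apply Hinc in H3; lra. }
exists G; split; [easy|].
intros y Hy; split; [auto|split; [apply GP; lra|]].
assert (Hwf : forall x, F a <= x -> x <= F b -> a <= G x <= b)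
  by (intros; apply GP; lra).
assert (Hid : forall x, F a <= x -> x <= F b -> comp F G x = id x)
  by (intros x Hx1 Hx2; exact (proj2 (GP x (conj Hx1 Hx2)))).
assert (HnG := GS y Hy).
assert (Hn : derive_pt F (G y)
   (derivable_pt_recip_interv_prelim1 F G a b y Hab Hy Hwf Hder) <> 0).
{ rewrite (derive_pt_eq_0 F (G y) (F' (G y))).
  - assert (0 < F' (G y)) by (apply Hpos; lra); lra.
  - apply is_derive_Reals, Hd; lra. }
destruct (derivable_pt_recip_interv F G a b y Hab Hy Hid Hwf Hinc Hder Hn) as [l Hl].
apply is_derive_Reals in Hl.
replace (/ F' (G y)) with l; [easy|].
(* The value of the derivative: differentiate [F (G y) = y]. *)
assert (H1 : is_derive (fun z => F (G z)) y (l * F' (G y))).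
{ apply (is_derive_comp F G); [|easy]; apply Hd; lra. }
assert (H2 : is_derive (fun z => F (G z)) y 1).
{ apply (is_derive_ext_loc (fun z => z)); [|apply @is_derive_id].
  generalize (in_interval_locally (F a) (F b) y Hy); apply filter_imp.
  intros z [Hz1 Hz2]; simpl in *; symmetry; apply GP; lra. }
assert (H3 : l * F' (G y) = 1).
{ rewrite <- (is_derive_unique _ _ _ H1); now apply is_derive_unique. }
assert (0 < F' (G y)) by (apply Hpos; lra).
rewrite <- (Rmult_1_l (/ _)), <- H3; field; lra.
Qed.

(** The inverse is smooth because its derivative [/ F' (G y)] is obtained from
    the smooth [F'] by composing with [G] itself: each order of
    differentiability of [G] yields the next one. *)
Lemma smooth_local_inverse lo hi (F : R -> R) (x0 : R) :
  smooth_on lo hi F -> in_interval lo hi x0 -> Derive F x0 <> 0 ->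
  exists (d : R) (G : R -> R),
    0 < d /\ smooth_on (F x0 - d) (F x0 + d) G /\ G (F x0) = x0 /\
    forall y, F x0 - d < y < F x0 + d ->
      in_interval lo hi (G y) /\ F (G y) = y /\ is_derive G y (/ Derive F (G y)).
Proof.
revert F.
assert (Hp : forall F, smooth_on lo hi F -> in_interval lo hi x0 ->
  0 < Derive F x0 ->
  exists (d : R) (G : R -> R),
    0 < d /\ smooth_on (F x0 - d) (F x0 + d) G /\ G (F x0) = x0 /\
    forall y, F x0 - d < y < F x0 + d ->
      in_interval lo hi (G y) /\ F (G y) = y /\ is_derive G y (/ Derive F (G y))).
{ intros F HF Dx0 Hpos.
  assert (HC : continuous (Derive F) x0).
  { apply (ex_derive_continuous (Derive F) x0), (HF 2%nat x0 Dx0). }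
  assert (HL : locally x0 (fun x => in_interval lo hi x /\ 0 < Derive F x)).
  { apply filter_and; [now apply in_interval_locally|].
    apply (HC (fun z => 0 < z)), (open_gt 0), Hpos. }
  destruct HL as [e He].
  set (a := x0 - e / 2); set (b := x0 + e / 2).
  assert (Pe := cond_pos e).
  assert (HI : forall x, a <= x <= b -> in_interval lo hi x /\ 0 < Derive F x).
  { intros x Hx; apply He; unfold a, b in Hx.
    apply Rabs_lt_between'; lra. }
  destruct (inverse_increasing a b F (Derive F)) as [G [G1 G2]].
  - unfold a, b; lra.
  - intros x Hx; apply Derive_correct, (HF 1%nat); now apply HI.
  - intros x Hx; now apply HI.
  - destruct (G1 x0) as [G3 G4]; [unfold a, b; lra|].
    set (d := Rmin (F x0 - F a) (F b - F x0)).
    assert (Pd : 0 < d) by (apply Rmin_case; lra).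
    assert (Hd : forall y, F x0 - d < y < F x0 + d -> F a < y < F b).
    { intros y Hy; generalize (Rmin_l (F x0 - F a) (F b - F x0)),
       (Rmin_r (F x0 - F a) (F b - F x0)); fold d; lra. }
    exists d, G; split; [easy|split; [|split; [easy|]]].
    + apply smooth_Ck; induction n as [|n IH]; [easy|].
      exists (fun y => / Derive F (G y)); split.
      * intros y Hy; apply G2, Hd, Hy.
      * apply Ck_inv.
        -- intros y Hy; apply Rgt_not_eq, HI.
           destruct (G2 y (Hd y Hy)); lra.
        -- apply (Ck_comp _ (fun x => a < x < b)); [|easy|].
           ++ apply (Ck_mono (in_interval lo hi)).
              ** intros x Hx; apply HI; lra.
              ** now apply smooth_Ck_Derive.
           ++ intros y Hy; apply G2, Hd, Hy.
    + intros y Hy; destruct (G2 y (Hd y Hy)) as [H1 H2].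
      split; [apply HI; lra|easy]. }
intros F HF Dx0 Hn.
(* A negative derivative is reduced to a positive one by reflecting the values. *)
destruct (Rlt_dec 0 (Derive F x0)) as [H|H]; [now apply Hp|].
destruct (Hp (fun x => - F x)) as [d [G [Pd [HG [HG0 HG1]]]]].
- intros n s Ds; apply (ex_derive_n_opp F n s), (HF n s Ds).
- easy.
- rewrite Derive_opp; lra.
- exists d, (fun y => G (- y)); split; [easy|split; [|split; [easy|]]].
  + apply smooth_Ck; intros n.
    apply (Ck_comp _ (in_interval (- F x0 - d) (- F x0 + d))).
    * now apply smooth_Ck.
    * apply (Ck_ext _ _ (fun y => -1 * y)).
      -- apply in_interval_locally.
      -- intros; ring.
      -- apply Ck_mult; [apply Ck_const|].
         destruct n as [|n]; [easy|].
         exists (fun _ => 1); split; [intros; apply @is_derive_id|apply Ck_const].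
    * intros y [Hy1 Hy2]; simpl in *; split; simpl; lra.
  + intros y Hy; destruct (HG1 (- y)) as [H1 [H2 H3]]; [lra|].
    split; [easy|split; [lra|]].
    rewrite Derive_opp in H3.
    replace (/ Derive F (G (- y))) with (-1 * / - Derive F (G (- y)))
      by (rewrite Rinv_opp; ring).
    apply (is_derive_comp G (fun z => - z)); [easy|].
    auto_derive; [easy|ring].
Qed.

(** * Velocities of plane curves *)

Ltac vec :=
  intros; repeat match goal with p : (R * R)%type |- _ => destruct p end;
  unfold minus, plus, opp, scal, zero; simpl;
  unfold prod_plus, prod_opp, prod_scal, plus, opp, scal, zero; simpl;
  unfold mult; simpl; apply f_equal2; ring.

Definition has_velocity (c : R -> R * R) (s : R) (w : R * R) : Prop :=
  is_derive (fun r => fst (c r)) s (fst w) /\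
  is_derive (fun r => snd (c r)) s (snd w).

Lemma has_velocity_unique c s w : has_velocity c s w -> velocity c s = w.
Proof.
intros [H1 H2]; rewrite (surjective_pairing w); unfold velocity.
now apply f_equal2; apply is_derive_unique.
Qed.

Lemma has_velocity_ext_loc c c' s w :
  locally s (fun r => c r = c' r) -> has_velocity c s w -> has_velocity c' s w.
Proof.
intros H [H1 H2]; split.
- apply (is_derive_ext_loc (fun r => fst (c r))); [|easy].
  revert H; apply filter_imp; now intros r ->.
- apply (is_derive_ext_loc (fun r => snd (c r))); [|easy].
  revert H; apply filter_imp; now intros r ->.
Qed.

Lemma has_velocity_comp c (h : R -> R) s w l :
  has_velocity c (h s) w -> is_derive h s l ->
  has_velocity (fun r => c (h r)) s (scal l w).
Proof.
intros [H1 H2] Hh; split.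
- now apply (is_derive_comp (fun r => fst (c r)) h).
- now apply (is_derive_comp (fun r => snd (c r)) h).
Qed.

Lemma has_velocity_minus c c' s w w' :
  has_velocity c s w -> has_velocity c' s w' ->
  has_velocity (fun r => minus (c r) (c' r)) s (minus w w').
Proof.
intros [H1 H2] [K1 K2]; split.
- now apply (is_derive_minus (fun r => fst (c r)) (fun r => fst (c' r))).
- now apply (is_derive_minus (fun r => snd (c r)) (fun r => snd (c' r))).
Qed.

Lemma has_velocity_scal (a : R -> R) c s a' w :
  is_derive a s a' -> has_velocity c s w ->
  has_velocity (fun r => scal (a r) (c r)) s
    (plus (scal a' (c s)) (scal (a s) w)).
Proof.
intros Ha [H1 H2]; split;
  apply (@is_derive_mult R_AbsRing a); auto; intros; apply Rmult_comm.
Qed.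

Lemma is_derive_dot c c' s w w' :
  has_velocity c s w -> has_velocity c' s w' ->
  is_derive (fun r => dot (c r) (c' r)) s (dot w (c' s) + dot (c s) w').
Proof.
intros [H1 H2] [K1 K2]; unfold dot.
replace (_ + _) with ((fst w * fst (c' s) + fst (c s) * fst w')
  + (snd w * snd (c' s) + snd (c s) * snd w')) by ring.
apply @is_derive_plus; apply @is_derive_mult; auto; intros; apply Rmult_comm.
Qed.

Lemma has_velocity_const (p : R * R) s : has_velocity (fun _ => p) s (0, 0).
Proof. split; apply @is_derive_const. Qed.

Lemma is_derive_dot_const (n : R * R) c s w :
  has_velocity c s w -> is_derive (fun r => dot n (c r)) s (dot n w).
Proof.
intros H.
replace (dot n w) with (dot (0, 0) (c s) + dot n w)
  by (unfold dot; simpl; ring).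
apply (is_derive_dot (fun _ => n) c); [apply has_velocity_const|easy].
Qed.

Lemma dot_scal_r p k q : dot p (scal k q) = k * dot p q.
Proof. unfold dot, scal; simpl; unfold prod_scal, scal; simpl; unfold mult; simpl; ring. Qed.

Lemma dot_scal_l p k q : dot (scal k p) q = k * dot p q.
Proof. unfold dot, scal; simpl; unfold prod_scal, scal; simpl; unfold mult; simpl; ring. Qed.

Lemma dot_plus_r p q q' : dot p (plus q q') = dot p q + dot p q'.
Proof. unfold dot, plus; simpl; unfold prod_plus, plus; simpl; ring. Qed.

Lemma det_scal_l p k q : det (scal k p) q = k * det p q.
Proof. unfold det, scal; simpl; unfold prod_scal, scal; simpl; unfold mult; simpl; ring. Qed.

Lemma det_scal_r p k q : det p (scal k q) = k * det p q.
Proof. unfold det, scal; simpl; unfold prod_scal, scal; simpl; unfold mult; simpl; ring. Qed.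

Lemma det_plus_r p q q' : det p (plus q q') = det p q + det p q'.
Proof. unfold det, plus; simpl; unfold prod_plus, plus; simpl; ring. Qed.

Lemma det_diag p : det p p = 0.
Proof. unfold det; ring. Qed.

Lemma norm_sqrt_dot (p : R * R) : norm p = sqrt (dot p p).
Proof.
destruct p as [x y]; unfold norm; simpl; unfold prod_norm; simpl.
apply f_equal; unfold norm; simpl; unfold abs, dot; simpl.
rewrite !Rmult_1_r, <- !Rabs_mult, !Rabs_pos_eq; [easy| |];
  apply Rle_0_sqr.
Qed.

Lemma dot_pos (p : R * R) : p <> zero -> 0 < dot p p.
Proof.
destruct p as [x y]; intros Hp; unfold dot; simpl.
destruct (Req_dec x 0) as [->|Hx].
- destruct (Req_dec y 0) as [->|Hy]; [now elim Hp|nra].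
- nra.
Qed.

Lemma norm_eq_1_dot (p : R * R) : norm p = 1 <-> dot p p = 1.
Proof.
assert (0 <= dot p p) by (unfold dot; nra).
rewrite norm_sqrt_dot; split; intros Hp.
- rewrite <- (sqrt_sqrt (dot p p)), Hp; lra.
- rewrite Hp; apply sqrt_1.
Qed.

Lemma param_velocity (M : regular_curve) s :
  in_dom M s -> has_velocity M s (velocity M s).
Proof.
intros Hs; split; apply Derive_correct.
- apply (param_smooth_fst M 1%nat s Hs).
- apply (param_smooth_snd M 1%nat s Hs).
Qed.

Lemma param_acceleration (M : regular_curve) s :
  in_dom M s -> has_velocity (velocity M) s (acceleration M s).
Proof.
intros Hs; split; apply Derive_correct.
- apply (param_smooth_fst M 2%nat s Hs).
- apply (param_smooth_snd M 2%nat s Hs).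
Qed.

(** * Curvature and the side of the tangent line *)

Lemma curvature_neq0 (M : regular_curve) u : in_dom M u ->
  curvature M u <> 0 <-> det (velocity M u) (acceleration M u) <> 0.
Proof.
intros Hu; unfold curvature.
assert (0 < norm (velocity M u)).
{ rewrite norm_sqrt_dot; apply sqrt_lt_R0, dot_pos, (param_regular M u Hu). }
assert (0 < norm (velocity M u) ^ 3) by now apply pow_lt.
split; intros H1 H2; apply H1.
- rewrite H2; field; lra.
- replace (det (velocity M u) (acceleration M u)) with
    (det (velocity M u) (acceleration M u) / norm (velocity M u) ^ 3
      * norm (velocity M u) ^ 3) by (field; lra).
  rewrite H2; ring.
Qed.

(** The determinant of velocity and acceleration is continuous, so the
    curvature keeps its sign near a point where it does not vanish. *)
Lemma curved_not_inflexion (M : regular_curve) u : in_dom M u ->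
  curvature M u <> 0 -> ~ inflexion M u.
Proof.
intros Hu Hk [eps [Heps Hinf]].
apply curvature_neq0 in Hk; [|easy].
set (D := fun s => det (velocity M s) (acceleration M s)).
assert (HC : continuous D u).
{ unfold D, det; simpl.
  apply @continuous_minus; apply @continuous_mult;
    apply @ex_derive_continuous;
    solve [apply (param_smooth_fst M 2%nat u Hu)
          |apply (param_smooth_snd M 2%nat u Hu)
          |apply (param_smooth_fst M 3%nat u Hu)
          |apply (param_smooth_snd M 3%nat u Hu)]. }
assert (HL : locally u (fun s => 0 < D u * D s)).
{ assert (HC' : continuous (fun s => D u * D s) u)
    by now apply @continuous_scal_r.
  apply (HC' (fun z => 0 < z)), (open_gt 0).
  apply (Rlt_0_sqr (D u) Hk). }
destruct HL as [e He].
set (x := Rmin eps e / 2).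
assert (Hx : 0 < x /\ x < eps /\ x < e).
{ generalize (Rmin_l eps e), (Rmin_r eps e), (cond_pos e); intros.
  assert (0 < Rmin eps e) by (apply Rmin_case; lra).
  unfold x; lra. }
assert (H1 : 0 < D u * D (u - x)) by (apply He, Rabs_lt_between'; lra).
assert (H2 : 0 < D u * D (u + x)) by (apply He, Rabs_lt_between'; lra).
assert (H3 := Hinf (u - x) (u + x) ltac:(lra) ltac:(lra)).
unfold curvature, Rdiv in H3; fold (D (u - x)) (D (u + x)) in H3.
assert (Hinv : forall p : R * R, 0 <= / norm p ^ 3).
{ intros p; generalize (norm_ge_0 p); intros [Hp|Hp].
  - left; now apply Rinv_0_lt_compat, pow_lt.
  - rewrite <- Hp, pow_ne_zero, Rinv_0; [lra|easy]. }
assert (H4 := Rmult_le_pos _ _ (Hinv (velocity M (u - x))) (Hinv (velocity M (u + x)))).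
assert (H5 : 0 < D (u - x) * D (u + x)) by nra.
nra.
Qed.

(** The increment estimate for [h'] at [x0] makes [h' x] a positive multiple of
    [x - x0]; the mean value theorem turns this into positivity of [h]. *)
Lemma second_derivative_test (h h' : R -> R) (x0 c : R) :
  locally x0 (fun x => is_derive h x (h' x)) -> is_derive h' x0 c ->
  h x0 = 0 -> h' x0 = 0 -> 0 < c ->
  locally x0 (fun x => x <> x0 -> 0 < h x).
Proof.
intros [e1 He1] [_ Hc] H0 H0' Pc.
assert (P2 : 0 < c / 2) by lra.
destruct (Hc x0 (fun P H => H) (mkposreal _ P2)) as [e2 He2].
assert (Pe : 0 < Rmin e1 e2) by (apply Rmin_case; apply cond_pos).
assert (Hs : forall x, Rabs (x - x0) < Rmin e1 e2 -> x <> x0 -> 0 < h' x * (x - x0)).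
{ intros x Hx Hn.
  specialize (He2 x); simpl in He2.
  assert (Hb : Rabs (h' x - h' x0 - (x - x0) * c) <= c / 2 * Rabs (x - x0)).
  { apply He2; change (Rabs (x - x0) < e2).
    generalize (Rmin_r e1 e2); lra. }
  rewrite H0' in Hb; apply Rabs_le_between in Hb.
  destruct (Rle_lt_dec 0 (x - x0)) as [Hp|Hp].
  - rewrite Rabs_pos_eq in Hb by easy.
    assert (0 < c / 2 * (x - x0)) by (apply Rmult_lt_0_compat; lra).
    apply Rmult_lt_0_compat; lra.
  - rewrite Rabs_left in Hb by easy.
    assert (0 < c / 2 * (x0 - x)) by (apply Rmult_lt_0_compat; lra).
    rewrite <- Rmult_opp_opp; apply Rmult_lt_0_compat; lra. }
exists (mkposreal _ Pe); intros x Hx Hn.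
change (Rabs (x - x0) < Rmin e1 e2) in Hx.
assert (He : forall y, Rabs (y - x0) < Rmin e1 e2 -> derivable_pt_lim h y (h' y)).
{ intros y Hy; apply is_derive_Reals, He1.
  change (Rabs (y - x0) < e1); generalize (Rmin_l e1 e2); lra. }
apply Rabs_lt_between' in Hx.
destruct (Rtotal_order x x0) as [Hl|[Hl|Hl]]; [|easy|].
- destruct (MVT_cor2 h h' x x0 Hl) as [y [Hy1 Hy2]].
  + intros y Hy; apply He, Rabs_lt_between'; lra.
  + assert (0 < h' y * (y - x0)) by (apply Hs; [apply Rabs_lt_between'|]; lra).
    assert (h' y < 0) by nra; nra.
- destruct (MVT_cor2 h h' x0 x Hl) as [y [Hy1 Hy2]].
  + intros y Hy; apply He, Rabs_lt_between'; lra.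
  + assert (0 < h' y * (y - x0)) by (apply Hs; [apply Rabs_lt_between'|]; lra).
    assert (0 < h' y) by nra; nra.
Qed.

Lemma locally_nonneg_iff (h h' : R -> R) (x0 c : R) :
  locally x0 (fun x => is_derive h x (h' x)) -> is_derive h' x0 c ->
  h x0 = 0 -> h' x0 = 0 -> c <> 0 ->
  (locally x0 (fun x => 0 <= h x) <-> 0 < c).
Proof.
intros H1 H2 H3 H4 Hc; split.
- intros Hp; apply Rnot_le_lt; intros Hc'.
  assert (HL : locally x0 (fun x => x <> x0 -> 0 < - h x)).
  { apply (second_derivative_test _ (fun x => - h' x) x0 (- c)).
    - revert H1; apply filter_imp; intros x Hx; now apply @is_derive_opp.
    - now apply @is_derive_opp.
    - lra.
    - lra.
    - lra. }
  destruct (filter_and _ _ Hp HL) as [e He].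
  assert (Pe := cond_pos e).
  destruct (He (x0 + e / 2)) as [K1 K2].
  + apply Rabs_lt_between'; lra.
  + assert (0 < - h (x0 + e / 2)) by (apply K2; lra); lra.
- intros Pc; generalize (second_derivative_test h h' x0 c H1 H2 H3 H4 Pc).
  apply filter_imp; intros x Hx.
  destruct (Req_dec x x0) as [->|Hn]; [lra|].
  now apply Rlt_le, Hx.
Qed.

(** The height of the curve over its tangent line vanishes to first order and
    has second derivative [dot n (acceleration M u)].  The latter is non-zero
    since otherwise [n] would be orthogonal to two independent vectors. *)
Lemma curve_side_iff (M : regular_curve) u (n : R * R) :
  in_dom M u -> curvature M u <> 0 -> n <> zero -> dot n (velocity M u) = 0 ->
  (locally u (fun r => 0 <= dot n (minus (M r) (M u))) <->
   0 < dot n (acceleration M u)).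
Proof.
intros Hu Hk Hn Hd.
apply (locally_nonneg_iff _ (fun r => dot n (velocity M r))).
- generalize (in_interval_locally _ _ _ Hu); apply filter_imp; intros r Hr.
  replace (dot n (velocity M r)) with (dot n (minus (velocity M r) (0, 0)))
    by (unfold dot, minus, plus, opp; simpl; unfold prod_plus, prod_opp, plus, opp; simpl; ring).
  apply is_derive_dot_const, has_velocity_minus;
    [now apply param_velocity|apply has_velocity_const].
- now apply is_derive_dot_const, param_acceleration.
- unfold dot, minus, plus, opp; simpl; unfold prod_plus, prod_opp, plus, opp; simpl; ring.
- easy.
- apply curvature_neq0 in Hk; [|easy].
  revert Hk Hd; generalize (velocity M u) (acceleration M u).
  destruct n as [n1 n2]; intros [v1 v2] [a1 a2]; unfold dot, det; simpl.
  intros Hk Hd Ha.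
  (* Cramer's rule for the system [dot n V = dot n A = 0] *)
  assert (E1 : n1 * (v1 * a2 - v2 * a1) = a2 * (n1 * v1 + n2 * v2) - v2 * (n1 * a1 + n2 * a2)) by ring.
  assert (E2 : n2 * (v1 * a2 - v2 * a1) = v1 * (n1 * a1 + n2 * a2) - a1 * (n1 * v1 + n2 * v2)) by ring.
  rewrite Ha, Hd in E1, E2.
  apply Hn; change zero with (0, 0); apply f_equal2; nra.
Qed.

(** * Arc length parameterizations *)

Section Arclength.
Variables (M : regular_curve) (u : R) (f : R -> R * R) (s0 s1 sa : R).
Hypothesis Hf : arclength_param M u f s0 s1 sa.

Lemma arclength_in_dom : in_dom M u.
Proof.
destruct Hf as [Hs [[phi [_ [<- H]]] _]]; now apply H.
Qed.

Lemma arclength_unit s : s0 < s < s1 -> dot (velocity f s) (velocity f s) = 1.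
Proof. intros Hs; now apply norm_eq_1_dot, Hf. Qed.

Lemma arclength_smooth :
  smooth_on s0 s1 (fun s => fst (f s)) /\ smooth_on s0 s1 (fun s => snd (f s)).
Proof.
destruct Hf as [Hs [[phi [Sphi [_ H]]] _]].
split; apply smooth_Ck; intros n.
- apply (Ck_ext _ _ (fun s => fst (M (phi s)))).
  + apply in_interval_locally.
  + intros x Hx; now rewrite (proj2 (H x Hx)).
  + apply (Ck_comp _ (in_dom M) n (fun x => fst (M x))).
    * apply smooth_Ck, param_smooth_fst.
    * now apply smooth_Ck.
    * intros x Hx; now apply H.
- apply (Ck_ext _ _ (fun s => snd (M (phi s)))).
  + apply in_interval_locally.
  + intros x Hx; now rewrite (proj2 (H x Hx)).
  + apply (Ck_comp _ (in_dom M) n (fun x => snd (M x))).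
    * apply smooth_Ck, param_smooth_snd.
    * now apply smooth_Ck.
    * intros x Hx; now apply H.
Qed.

Lemma arclength_velocity s : s0 < s < s1 -> has_velocity f s (velocity f s).
Proof.
intros Hs; split; apply Derive_correct.
- apply (proj1 arclength_smooth 1%nat s Hs).
- apply (proj2 arclength_smooth 1%nat s Hs).
Qed.

Lemma arclength_acceleration s :
  s0 < s < s1 -> has_velocity (velocity f) s (acceleration f s).
Proof.
intros Hs; split; apply Derive_correct.
- apply (proj1 arclength_smooth 2%nat s Hs).
- apply (proj2 arclength_smooth 2%nat s Hs).
Qed.

Lemma arclength_orthogonal s :
  s0 < s < s1 -> dot (velocity f s) (acceleration f s) = 0.
Proof.
intros Hs.
assert (H1 := is_derive_dot _ _ _ _ _ (arclength_acceleration s Hs)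
                (arclength_acceleration s Hs)).
assert (H2 : is_derive (fun r => dot (velocity f r) (velocity f r)) s 0).
{ apply (is_derive_ext_loc (fun _ => 1)); [|apply @is_derive_const].
  generalize (in_interval_locally s0 s1 s Hs); apply filter_imp; intros r Hr.
  symmetry; now apply arclength_unit. }
assert (H3 := eq_trans (eq_sym (is_derive_unique _ _ _ H1)) (is_derive_unique _ _ _ H2)).
revert H3; unfold dot; lra.
Qed.

(** With [f] = [M] after [phi], the factors are [l = phi'] and [m = phi''].
    The sign of [l], i.e. the orientation of [f], is left open. *)
Lemma arclength_derivatives : exists l m : R,
  l <> 0 /\
  velocity f sa = scal l (velocity M u) /\
  acceleration f sa =
    plus (scal m (velocity M u)) (scal (l * l) (acceleration M u)).
Proof.
destruct Hf as [Hs [[phi [Sphi [Hphi H]]] _]].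
assert (Hv : forall s, s0 < s < s1 ->
  velocity f s = scal (Derive phi s) (velocity M (phi s))).
{ intros s Hss; apply has_velocity_unique.
  apply (has_velocity_ext_loc (fun r => M (phi r))).
  - generalize (in_interval_locally s0 s1 s Hss); apply filter_imp; intros r Hr.
    symmetry; now apply H.
  - apply has_velocity_comp; [now apply param_velocity, H|].
    apply Derive_correct, (Sphi 1%nat s Hss). }
exists (Derive phi sa), (Derive (Derive phi) sa); split; [|split].
- intros H0; generalize (arclength_unit sa Hs); rewrite Hv, H0 by easy.
  rewrite dot_scal_l; lra.
- rewrite <- Hphi; now apply Hv.
- change (acceleration f sa) with (velocity (velocity f) sa).
  apply has_velocity_unique.
  apply (has_velocity_ext_loc (fun s => scal (Derive phi s) (velocity M (phi s)))).
  + generalize (in_interval_locally s0 s1 sa Hs); apply filter_imp; intros r Hr.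
    symmetry; now apply Hv.
  + rewrite <- Hphi.
    replace (scal (Derive phi sa * Derive phi sa) (acceleration M (phi sa))) with
      (scal (Derive phi sa) (scal (Derive phi sa) (acceleration M (phi sa)))).
    * apply (has_velocity_scal (Derive phi) (fun s => velocity M (phi s))).
      -- apply Derive_correct, (Sphi 2%nat sa Hs).
      -- apply has_velocity_comp; [now apply param_acceleration, H|].
         apply Derive_correct, (Sphi 1%nat sa Hs).
    * now rewrite scal_assoc.
Qed.

(** [det] picks up the factor [l ^ 3] under reparameterization, and
    [|l| * norm (velocity M u) = 1] since [f] has unit speed. *)
Lemma arclength_curvature :
  Rabs (curvature M u) = Rabs (det (velocity f sa) (acceleration f sa)).
Proof.
destruct arclength_derivatives as [l [m [Hl [HT HA]]]].
assert (Hu := arclength_unit sa (proj1 Hf)).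
rewrite HT, dot_scal_l, dot_scal_r in Hu.
rewrite HT, HA, det_scal_l, det_plus_r, !det_scal_r, det_diag.
unfold curvature, Rdiv.
rewrite norm_sqrt_dot.
set (N := sqrt (dot (velocity M u) (velocity M u))).
assert (PN : 0 < N) by apply sqrt_lt_R0, dot_pos, (param_regular M u arclength_in_dom).
assert (HN : N * N = dot (velocity M u) (velocity M u)) by (apply sqrt_sqrt; nra).
rewrite <- HN in Hu.
assert (HlN : Rabs l * N = 1).
{ assert (Rabs l * Rabs l = l * l) by (rewrite <- Rabs_mult; apply Rabs_pos_eq; nra).
  assert (0 <= Rabs l) by apply Rabs_pos.
  assert (E : (Rabs l * N - 1) * (Rabs l * N + 1) = 0).
  { replace ((Rabs l * N - 1) * (Rabs l * N + 1)) with
      ((Rabs l * Rabs l) * (N * N) - 1) by ring.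
    rewrite H; lra. }
  apply Rmult_integral in E; nra. }
replace (l * (m * 0 + l * l * det (velocity M u) (acceleration M u)))
  with (l * l * l * det (velocity M u) (acceleration M u)) by ring.
rewrite !Rabs_mult, Rabs_inv, (Rabs_pos_eq (N ^ 3)) by (apply pow_le; lra).
replace (/ N ^ 3) with (Rabs l * Rabs l * Rabs l); [ring|].
replace (Rabs l) with (/ N); [field; lra|].
rewrite <- (Rmult_1_l (/ N)), <- HlN; field; lra.
Qed.

(** The reparameterization changes the acceleration by a tangential term, which
    [n] does not see, and by the positive factor [l * l]. *)
Lemma arclength_side_iff (n : R * R) :
  curvature M u <> 0 -> n <> zero -> dot n (velocity M u) = 0 ->
  (locally u (fun r => 0 <= dot n (minus (M r) (M u))) <->
   0 < dot n (acceleration f sa)).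
Proof.
intros Hk Hn Hd.
rewrite (curve_side_iff M u n arclength_in_dom Hk Hn Hd).
destruct arclength_derivatives as [l [m [Hl [_ HA]]]].
rewrite HA, dot_plus_r, !dot_scal_r, Hd.
assert (0 < l * l) by nra.
split; intros; nra.
Qed.

End Arclength.

(** * The velocity of the natural parameterization *)

Section Matching.
Variables (M : regular_curve) (u v : R).
Variables (f : R -> R * R) (s0 s1 sa : R) (g : R -> R * R) (t0 t1 tb : R).
Hypothesis Hf : arclength_param M u f s0 s1 sa.
Hypothesis Hg : arclength_param M v g t0 t1 tb.
Variable t : R -> R.
Hypothesis Ht : tangent_matching f s0 s1 sa g t0 t1 tb t.

(** The factor [l] is the derivative of [t] at [sa]. *)
Lemma matching_derivatives : exists l : R,
  acceleration f sa = scal l (acceleration g tb) /\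
  has_velocity (fun r => minus (f r) (g (t r))) sa
    (scal (1 - l) (velocity f sa)).
Proof.
destruct Ht as [St [Hb H]].
assert (Hs := proj1 Hf); assert (Htb := proj1 Hg).
assert (Dt : is_derive t sa (Derive t sa)) by apply Derive_correct, (St 1%nat sa Hs).
exists (Derive t sa); split.
- change (acceleration f sa) with (velocity (velocity f) sa).
  apply has_velocity_unique, (has_velocity_ext_loc (fun s => velocity g (t s))).
  + generalize (in_interval_locally s0 s1 sa Hs); apply filter_imp; intros r Hr.
    symmetry; now apply H.
  + rewrite <- Hb in *; apply has_velocity_comp; [|easy].
    now apply (arclength_acceleration M v g t0 t1 (t sa)).
- replace (scal (1 - Derive t sa) (velocity f sa)) with
    (minus (velocity f sa) (scal (Derive t sa) (velocity g (t sa)))).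
  + apply has_velocity_minus.
    * now apply (arclength_velocity M u f s0 s1 sa).
    * apply has_velocity_comp; [|easy].
      rewrite Hb; now apply (arclength_velocity M v g t0 t1 tb).
  + rewrite <- (proj2 (H sa Hs)).
    generalize (velocity f sa) (Derive t sa); vec.
Qed.

Lemma scal_velocity_eq0 k : scal k (velocity f sa) = zero <-> k = 0.
Proof.
split; intros H; [|rewrite H; apply @scal_zero_l].
assert (Hu := arclength_unit M u f s0 s1 sa Hf sa (proj1 Hf)).
rewrite <- (Rmult_1_r k), <- Hu, <- dot_scal_r, H.
unfold dot, zero; simpl; unfold zero; simpl; ring.
Qed.

Lemma dot_minus_shift (n p q r : R * R) :
  dot n (minus (plus p (minus r q)) r) = dot n (minus p q).
Proof.
unfold dot, minus, plus, opp; simpl.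
unfold prod_plus, prod_opp, plus, opp; simpl; ring.
Qed.

(** With [A = l B] for the accelerations [A] of [f] and [B] of [g], the
    normal [n] witnessing curvature on the same side satisfies
    [0 < dot n A = l * dot n B] and [0 < dot n B], whence [0 < l]; conversely,
    for [l = 1] the vector [B] is such a normal. *)
Lemma velocity_eq0_iff_same_side : curvature M v <> 0 ->
  velocity (fun r => minus (f r) (g (t r))) sa = zero <->
  curved_same_side M u v /\ Rabs (curvature M u) = Rabs (curvature M v).
Proof.
intros Hkv.
destruct matching_derivatives as [l [HA Hvel]].
rewrite (has_velocity_unique _ _ _ Hvel), scal_velocity_eq0.
assert (HT : velocity f sa = velocity g tb).
{ destruct Ht as [_ [<- H]]; now apply H, Hf. }
assert (Hu := arclength_in_dom M u f s0 s1 sa Hf).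
assert (Hv := arclength_in_dom M v g t0 t1 tb Hg).
assert (Cv := arclength_curvature M v g t0 t1 tb Hg).
assert (Cu : Rabs (curvature M u) = Rabs l * Rabs (curvature M v)).
{ rewrite Cv, (arclength_curvature M u f s0 s1 sa Hf), HA, det_scal_r, HT.
  apply Rabs_mult. }
assert (Pk : 0 < Rabs (curvature M v)) by now apply Rabs_pos_lt.
assert (Su := arclength_side_iff M u f s0 s1 sa Hf).
assert (Sv := arclength_side_iff M v g t0 t1 tb Hg).
assert (Hku : l <> 0 -> curvature M u <> 0).
{ intros Hl H0; rewrite H0, Rabs_R0 in Cu.
  assert (0 < Rabs l) by now apply Rabs_pos_lt.
  nra. }
assert (Orth : forall n, dot n (velocity M u) = 0 <-> dot n (velocity g tb) = 0).
{ intros n; destruct (arclength_derivatives M u f s0 s1 sa Hf) as [k [m [Hk [E _]]]].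
  rewrite <- HT, E, dot_scal_r; split; [intros ->; ring|].
  intros H; apply Rmult_integral in H; tauto. }
assert (Orth' : forall n, dot n (velocity M v) = 0 <-> dot n (velocity g tb) = 0).
{ intros n; destruct (arclength_derivatives M v g t0 t1 tb Hg) as [k [m [Hk [E _]]]].
  rewrite E, dot_scal_r; split; [intros ->; ring|].
  intros H; apply Rmult_integral in H; tauto. }
split.
- intros Hl; assert (l = 1) by lra; subst l.
  rewrite Rabs_R1, Rmult_1_l in Cu.
  specialize (Hku ltac:(lra)).
  split; [|easy].
  split; [now apply curved_not_inflexion|split; [now apply curved_not_inflexion|]].
  assert (HA' : acceleration f sa = acceleration g tb)
    by (rewrite HA; apply @scal_one).
  assert (Hn : acceleration g tb <> zero).
  { intros H0; rewrite Cv, H0 in Pk.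
    replace (det _ zero) with 0 in Pk
      by (unfold det, zero; simpl; unfold zero; simpl; ring).
    rewrite Rabs_R0 in Pk; lra. }
  assert (Ho : dot (acceleration g tb) (velocity g tb) = 0).
  { rewrite <- (arclength_orthogonal M v g t0 t1 tb Hg tb (proj1 Hg)).
    unfold dot; ring. }
  exists (acceleration g tb); split; [easy|].
  split; [now apply Orth|split].
  + apply Su; [easy|easy|now apply Orth|].
    rewrite HA'; now apply dot_pos.
  + apply (filter_imp (fun r => 0 <= dot (acceleration g tb) (minus (M r) (M v)))).
    * intros r; now rewrite dot_minus_shift.
    * apply Sv; [easy|easy|now apply Orth'|now apply dot_pos].
- intros [[_ [_ [n [Hn [Hd [Lu Lv]]]]]] Hk].
  assert (Hl : Rabs l = 1).
  { apply (Rmult_eq_reg_r (Rabs (curvature M v))); lra. }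
  assert (Hl0 : l <> 0) by (intros H0; rewrite H0, Rabs_R0 in Hl; lra).
  apply Su in Lu; [|now apply Hku|easy|easy].
  apply (filter_imp _ (fun r => 0 <= dot n (minus (M r) (M v)))) in Lv;
    [|intros r; now rewrite dot_minus_shift].
  apply Sv in Lv; [|easy|easy|now apply Orth', Orth].
  rewrite HA, dot_scal_r in Lu.
  assert (0 < l) by nra.
  rewrite Rabs_pos_eq in Hl; lra.
Qed.

End Matching.

(** * Existence of a natural parameterization *)

Lemma arclength_restrict M u f s0 s1 sa r0 r1 :
  arclength_param M u f s0 s1 sa -> s0 <= r0 -> r0 < sa < r1 -> r1 <= s1 ->
  arclength_param M u f r0 r1 sa.
Proof.
intros [Hs [[phi [Sphi [Hphi H]]] Hn]] H0 H1 H2; split; [easy|split].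
- exists phi; split; [|split; [easy|intros s Hss; apply H; lra]].
  apply smooth_Ck; intros m; apply (Ck_mono (in_interval s0 s1)).
  + intros x [Hx0 Hx1]; simpl in *; split; simpl; lra.
  + now apply smooth_Ck.
- intros s Hss; apply Hn; lra.
Qed.

Lemma locally_sym_interval (P : R -> Prop) (d : R) :
  0 < d -> locally 0 P ->
  exists e, 0 < e <= d /\ forall s, - e < s < e -> P s.
Proof.
intros Pd [e He]; exists (Rmin d e); split.
- split; [apply Rmin_case; [easy|apply cond_pos]|apply Rmin_l].
- intros s Hs; apply He, Rabs_lt_between'.
  generalize (Rmin_r d e); lra.
Qed.

(** The parameter change is the inverse of the arc length measured from [u],
    with the sign [eps] of the orientation built into the integrand.  The domain
    is shrunk so that the tangent stays in the open half-plane around its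
    initial direction; there a unit vector is determined by its determinant
    with that direction. *)
Lemma arclength_exists (M : regular_curve) u (eps : R) :
  in_dom M u -> eps * eps = 1 ->
  exists (d : R) (f : R -> R * R),
    0 < d /\ arclength_param M u f (- d) d 0 /\
    (exists k, 0 < k /\ velocity f 0 = scal (eps * k) (velocity M u)) /\
    forall s, - d < s < d -> 0 < dot (velocity f 0) (velocity f s).
Proof.
intros Hu Heps.
pose (sigma := fun x => eps * sqrt (dot (velocity M x) (velocity M x))).
assert (Sv : forall n, Ck (in_dom M) n (fun x => fst (velocity M x)) /\
                       Ck (in_dom M) n (fun x => snd (velocity M x))).
{ intros n; split; apply (smooth_Ck_Derive (dom_lo M) (dom_hi M)).
  - apply param_smooth_fst.
  - apply param_smooth_snd. }
assert (Ssigma : forall n, Ck (in_dom M) n sigma).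
{ intros n; apply Ck_mult; [apply Ck_const|].
  apply Ck_sqrt.
  - intros x Hx; apply dot_pos, (param_regular M x Hx).
  - apply Ck_plus; apply Ck_mult; apply Sv. }
assert (Csigma : forall x, in_dom M x -> continuous sigma x).
{ intros x Hx; destruct (Ssigma 1%nat) as [h [H _]].
  apply @ex_derive_continuous; exists (h x); now apply H. }
assert (Psigma : forall x, in_dom M x ->
  sigma x <> 0 /\ sigma x * sigma x = dot (velocity M x) (velocity M x)).
{ intros x Hx; unfold sigma.
  assert (Hp := dot_pos _ (param_regular M x Hx)).
  assert (Hs := sqrt_lt_R0 _ Hp).
  assert (He : eps <> 0) by nra.
  split; [apply Rmult_integral_contrapositive; split; [easy|lra]|].
  rewrite <- (sqrt_sqrt (dot (velocity M x) (velocity M x))) at 3 by lra.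
  transitivity (eps * eps * (sqrt (dot (velocity M x) (velocity M x)) *
    sqrt (dot (velocity M x) (velocity M x)))); [ring|rewrite Heps; ring]. }
pose (L := fun x => RInt sigma u x).
assert (DL : forall x, in_dom M x -> is_derive L x (sigma x)).
{ intros x Hx; apply (is_derive_RInt sigma L u); [|now apply Csigma].
  generalize (in_interval_locally _ _ _ Hx); apply filter_imp; intros y Hy.
  apply (RInt_correct sigma u y), (ex_RInt_continuous sigma u y).
  intros z Hz; apply Csigma.
  destruct Hu as [Hu1 Hu2], Hy as [Hy1 Hy2].
  split.
  - apply (Rbar_lt_le_trans _ (Rmin u y)); [|apply Hz].
    now apply Rmin_case.
  - apply (Rbar_le_lt_trans _ (Rmax u y)); [apply Hz|].
    now apply Rmax_case. }
assert (SL : smooth_on (dom_lo M) (dom_hi M) L).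
{ apply smooth_Ck; intros [|n]; [easy|]; exists sigma; split; [easy|apply Ssigma]. }
assert (L0 : L u = 0) by apply @RInt_point.
destruct (smooth_local_inverse _ _ L u SL Hu) as [d [phi [Pd [Sphi [Hphi H]]]]].
{ rewrite (is_derive_unique _ _ _ (DL u Hu)); now apply Psigma. }
rewrite L0, Rminus_0_l, Rplus_0_l in *.
pose (f := fun s => M (phi s)).
assert (Vf : forall s, - d < s < d ->
  velocity f s = scal (/ sigma (phi s)) (velocity M (phi s))).
{ intros s Hs; destruct (H s Hs) as [H1 [H2 H3]].
  rewrite (is_derive_unique _ _ _ (DL _ H1)) in H3.
  apply has_velocity_unique, (has_velocity_comp M phi); [|easy].
  now apply param_velocity. }
assert (Af : arclength_param M u f (- d) d 0).
{ split; [lra|split].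
  - exists phi; split; [easy|split; [easy|]].
    intros s Hs; split; [now apply H|easy].
  - intros s Hs; apply norm_eq_1_dot; rewrite Vf by easy.
    rewrite dot_scal_l, dot_scal_r.
    destruct (Psigma (phi s)) as [H1 <-]; [now apply H|].
    now field. }
assert (H00 : - d < 0 < d) by lra.
assert (Loc : locally 0 (fun s => 0 < dot (velocity f 0) (velocity f s))).
{ assert (HC : continuous (fun s => dot (velocity f 0) (velocity f s)) 0).
  { apply @ex_derive_continuous; exists (dot (velocity f 0) (acceleration f 0)).
    now apply is_derive_dot_const, (arclength_acceleration M u f (- d) d 0). }
  apply (HC (fun z => 0 < z)), (open_gt 0).
  rewrite (arclength_unit M u f (- d) d 0 Af 0 H00); lra. }
destruct (locally_sym_interval _ d Pd Loc) as [e [He1 He2]].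
exists e, f; split; [easy|split; [|split; [|easy]]].
- apply (arclength_restrict M u f (- d) d); [easy|lra|lra|lra].
- exists (/ sqrt (dot (velocity M u) (velocity M u))).
  assert (Hs := sqrt_lt_R0 _ (dot_pos _ (param_regular M u Hu))).
  split; [now apply Rinv_0_lt_compat|].
  rewrite Vf, Hphi by easy; apply f_equal2; [|easy].
  unfold sigma; rewrite Rinv_mult; apply f_equal2; [|easy].
  apply (Rmult_eq_reg_l eps); [|nra]; rewrite Heps; field; nra.
Qed.

(** [t] is the local inverse of [det T g'] composed with [det T f'], where [T]
    is the common tangent vector. *)
Lemma matching_exists M u v f d g e :
  arclength_param M u f (- d) d 0 -> arclength_param M v g (- e) e 0 ->
  velocity f 0 = velocity g 0 ->
  (forall s, - d < s < d -> 0 < dot (velocity f 0) (velocity f s)) ->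
  (forall s, - e < s < e -> 0 < dot (velocity g 0) (velocity g s)) ->
  curvature M v <> 0 ->
  exists (r : R) (t : R -> R), 0 < r <= d /\
    tangent_matching f (- r) r 0 g (- e) e 0 t.
Proof.
intros Hf Hg HT Pf Pg Hk.
set (T := velocity g 0) in *.
assert (Hd := proj1 Hf); assert (He := proj1 Hg).
assert (Sdet : forall c lo hi n,
  smooth_on lo hi (fun s => fst (c s)) -> smooth_on lo hi (fun s => snd (c s)) ->
  Ck (in_interval lo hi) n (fun s => det T (velocity c s))).
{ intros c lo hi n S1 S2.
  apply (Ck_ext _ _ (fun s => fst T * Derive (fun r => snd (c r)) s
                     + (- snd T) * Derive (fun r => fst (c r)) s)).
  - apply in_interval_locally.
  - intros s Hs; unfold det, velocity; simpl; ring.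
  - apply Ck_plus; apply Ck_mult; try apply Ck_const; now apply smooth_Ck_Derive. }
pose (F := fun s => det T (velocity g s)).
pose (K := fun s => det T (velocity f s)).
assert (SF : smooth_on (- e) e F).
{ apply smooth_Ck; intros n; apply Sdet; apply (arclength_smooth M v g (- e) e 0 Hg). }
assert (SK : smooth_on (- d) d K).
{ apply smooth_Ck; intros n; apply Sdet; apply (arclength_smooth M u f (- d) d 0 Hf). }
assert (F0 : F 0 = 0) by apply det_diag.
assert (K0 : K 0 = 0) by (unfold K; rewrite HT; apply det_diag).
destruct (smooth_local_inverse (- e) e F 0 SF) as [b [G [Pb [SG [G0 HG]]]]].
- easy.
- assert (HD : is_derive F 0 (det T (acceleration g 0))).
  { destruct (arclength_acceleration M v g (- e) e 0 Hg 0 He) as [A1 A2].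
    unfold F, det; apply @is_derive_minus; now apply is_derive_scal. }
  rewrite (is_derive_unique _ _ _ HD).
  intros H0; apply Rabs_no_R0 in Hk; apply Hk.
  rewrite (arclength_curvature M v g (- e) e 0 Hg); fold T; rewrite H0.
  apply Rabs_R0.
- rewrite F0, Rminus_0_l, Rplus_0_l in *.
  assert (Loc : locally 0 (fun s => - b < K s < b)).
  { assert (HC : continuous K 0) by (apply @ex_derive_continuous, (SK 1%nat 0 Hd)).
    apply (HC (in_interval (- b) b)), in_interval_locally.
    rewrite K0; split; simpl; lra. }
  destruct (locally_sym_interval _ d (proj2 Hd) Loc) as [r [Hr HK]].
  exists r, (fun s => G (K s)); split; [easy|split; [|split]].
  + apply smooth_Ck; intros n; apply (Ck_comp _ (in_interval (- b) b)).
    * now apply smooth_Ck.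
    * apply (Ck_mono (in_interval (- d) d)).
      -- intros x [Hx1 Hx2]; simpl in *; split; simpl; lra.
      -- now apply smooth_Ck.
    * intros x [Hx1 Hx2]; now apply (HK x).
  + now rewrite K0.
  + intros s Hs; destruct (HG (K s) (HK s Hs)) as [H1 [H2 _]].
    assert (Hsd : - d < s < d) by lra.
    split; [easy|].
    (* The two tangents are unit vectors with the same determinant with [T]; by
       Lagrange's identity their scalar products with [T] agree up to sign, and
       both are positive. *)
    assert (Uf := arclength_unit M u f (- d) d 0 Hf s Hsd).
    assert (Ug := arclength_unit M v g (- e) e 0 Hg (G (K s)) H1).
    assert (UT := arclength_unit M v g (- e) e 0 Hg 0 He).
    specialize (Pf s Hsd); specialize (Pg _ H1).
    rewrite HT in Pf.
    fold T in UT.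
    unfold F in H2; change (K s) with (det T (velocity f s)) in H2 at 2.
    revert Uf Ug UT Pf Pg H2.
    generalize T (velocity f s) (velocity g (G (K s))).
    intros [a1 a2] [p1 p2] [q1 q2]; unfold dot, det; simpl.
    intros Uf Ug UT Pf Pg H2.
    assert (E : a1 * p1 + a2 * p2 = a1 * q1 + a2 * q2).
    { assert (E2 : (a1 * p1 + a2 * p2) ^ 2 = (a1 * q1 + a2 * q2) ^ 2).
      { transitivity ((a1 * a1 + a2 * a2) * (p1 * p1 + p2 * p2)
          - (a1 * p2 - a2 * p1) ^ 2); [ring|].
        rewrite Uf, <- Ug, <- H2; ring. }
      nra. }
    apply f_equal2.
    * transitivity ((a1 * a1 + a2 * a2) * p1); [rewrite UT; ring|].
      transitivity ((a1 * a1 + a2 * a2) * q1); [|rewrite UT; ring].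
      transitivity (a1 * (a1 * p1 + a2 * p2) - a2 * (a1 * p2 - a2 * p1)); [ring|].
      rewrite E, <- H2; ring.
    * transitivity ((a1 * a1 + a2 * a2) * p2); [rewrite UT; ring|].
      transitivity ((a1 * a1 + a2 * a2) * q2); [|rewrite UT; ring].
      transitivity (a2 * (a1 * p1 + a2 * p2) + a1 * (a1 * p2 - a2 * p1)); [ring|].
      rewrite E, <- H2; ring.
Qed.

Lemma unit_scal_eq (a b : R) (p q : R * R) :
  dot p p = 1 -> dot q q = 1 -> 0 < a -> p = scal a q -> p = q.
Proof.
intros Hp Hq Ha H.
rewrite H, dot_scal_l, dot_scal_r, Hq in Hp.
assert (a = 1) by nra.
rewrite H, H0; apply @scal_one.
Qed.

(** The velocities of [M] at the pair may be opposite; the sign of [k] decides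
    the orientation of the second branch. *)
Lemma natural_param_exists M u v :
  parallel_pair M u v -> curvature M v <> 0 ->
  exists f s0 s1 sa g t0 t1 tb t,
    arclength_param M u f s0 s1 sa /\
    arclength_param M v g t0 t1 tb /\
    tangent_matching f s0 s1 sa g t0 t1 tb t.
Proof.
intros [Hu [Hv [_ [k [Hk Huv]]]]] Hkv.
assert (Heps : exists eps, eps * eps = 1 /\ 0 < eps * k).
{ destruct (Rlt_dec 0 k) as [H|H]; [exists 1|exists (-1)]; lra. }
destruct Heps as [eps [He1 He2]].
destruct (arclength_exists M u 1 Hu) as [d [f [Pd [Hf [[a [Pa Va]] Pf]]]]]; [ring|].
destruct (arclength_exists M v eps Hv He1) as [e [g [Pe [Hg [[b [Pb Vb]] Pg]]]]].
assert (HT : velocity f 0 = velocity g 0).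
{ apply (unit_scal_eq (a * (eps * k) * / b) 0).
  - now apply (arclength_unit M u f (- d) d 0), Hf.
  - now apply (arclength_unit M v g (- e) e 0), Hg.
  - apply Rmult_lt_0_compat; [now apply Rmult_lt_0_compat|].
    now apply Rinv_0_lt_compat.
  - rewrite Va, Vb, Huv, !scal_assoc.
    apply f_equal2; [|easy].
    unfold mult; simpl.
    transitivity (a * (eps * eps) * k * (/ b * b)); [|ring].
    rewrite He1, Rinv_l by lra; ring. }
destruct (matching_exists M u v f d g e Hf Hg HT Pf Pg Hkv) as [r [t [Hr Ht]]].
exists f, (- r), r, 0, g, (- e), e, 0, t.
split; [|easy].
apply (arclength_restrict M u f (- d) d); [easy|lra|lra|lra].
Qed.

Theorem proposition2p19 (M : regular_curve) (u v : R)
  (hpar : parallel_pair M u v)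
  (hcurv : curvature M u <> 0 \/ curvature M v <> 0) :
  SC_singular M u v <->
  (curved_same_side M u v /\ Rabs (curvature M u) = Rabs (curvature M v)).
Proof.
split.
- intros [c [p [[f [s0 [s1 [sa [g [t0 [t1 [tb [Hf [Hg [_ H]]]]]]]]]]] Hc]]].
  destruct H as [[Hkv [-> [t [Ht E]]]]|[Hkv [Hku [-> [s [Hs E]]]]]].
  + apply (velocity_eq0_iff_same_side M u v f s0 s1 sa g t0 t1 tb Hf Hg t Ht Hkv).
    rewrite <- Hc.
    destruct (matching_derivatives M u v f s0 s1 sa g t0 t1 tb Hf Hg t Ht) as [l [_ HV]].
    rewrite (has_velocity_unique _ _ _ HV); symmetry; apply has_velocity_unique.
    apply (has_velocity_ext_loc (fun r => minus (f r) (g (t r)))); [|easy].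
    generalize (in_interval_locally s0 s1 sa (proj1 Hf)); apply filter_imp; intros r Hr.
    symmetry; now apply E.
    (* A singular point would force equal absolute curvatures, one of them 0. *)
  + exfalso.
    destruct (matching_derivatives M v u g t0 t1 tb f s0 s1 sa Hg Hf s Hs) as [l [HA HV]].
    assert (HT : velocity g tb = velocity f sa).
    { destruct Hs as [_ [<- Hs]]; now apply Hs, Hg. }
    assert (Hv : has_velocity c tb (minus (0, 0) (scal (1 - l) (velocity g tb)))).
    { apply (has_velocity_ext_loc
        (fun r => minus (0, 0) (minus (g r) (f (s r))))).
      - generalize (in_interval_locally t0 t1 tb (proj1 Hg)); apply filter_imp; intros r Hr.
        rewrite E by easy; generalize (g r) (f (s r)); vec.
      - apply has_velocity_minus; [apply has_velocity_const|easy]. }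
    assert (Hl : l - 1 = 0).
    { apply (scal_velocity_eq0 M v g t0 t1 tb Hg).
      refine (eq_trans _ (eq_trans (eq_sym (has_velocity_unique _ _ _ Hv)) Hc)).
      generalize (velocity g tb); vec. }
    replace l with 1 in HA by lra.
    apply (Rabs_no_R0 _ Hku).
    rewrite (arclength_curvature M u f s0 s1 sa Hf), <- HT.
    replace (acceleration f sa) with (acceleration g tb)
      by (rewrite HA; apply @scal_one).
    rewrite <- (arclength_curvature M v g t0 t1 tb Hg), Hkv; apply Rabs_R0.
- intros Hss.
  assert (Hkv : curvature M v <> 0).
  { destruct hcurv as [H|H]; [|easy].
    apply Rabs_no_R0 in H; intros H0; apply H.
    rewrite (proj2 Hss), H0; apply Rabs_R0. }
  destruct (natural_param_exists M u v hpar Hkv)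
    as [f [s0 [s1 [sa [g [t0 [t1 [tb [t [Hf [Hg Ht]]]]]]]]]]].
  exists (fun r => minus (f r) (g (t r))), sa; split.
  + exists f, s0, s1, sa, g, t0, t1, tb; repeat (split; [easy|]); split.
    * exists 1; split; [lra|].
      transitivity (velocity g tb).
      -- destruct Ht as [_ [<- Ht]]; now apply Ht, Hf.
      -- symmetry; apply @scal_one.
    * left; split; [easy|split; [easy|]]; now exists t.
  + now apply (velocity_eq0_iff_same_side M u v f s0 s1 sa g t0 t1 tb Hf Hg t Ht Hkv).
Qed.
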